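(* For every $n\ge 1$, the total number $A(n)$ of attractors of the Pulse update on $K_n^\rightarrow$ is $$A(n)=F(n)+C(n),$$ where $F(n)$ is the number of fixed points and $C(n)$ the number of complement two-cycles of $K_n^\rightarrow$.
   Context: $K_n^\rightarrow$ denotes the complete directed graph on $n$ vertices (vertex set $V$) with no self-loops: for every pair of vertices $u\neq v$ the edge $u\to v$ is present. The Pulse update on a loopless directed graph $(V,E)$ acts on states $x_t:V\to\{0,1\}$ synchronously: with $k_t(v)=\sum_{u:(u,v)\in E}x_t(u)$, one sets $x_{t+1}(v)=1$ if $k_t(v)$ is a prime number and $x_{t+1}(v)=0$ otherwise. States are identified with their active sets $\{v\in V:x_t(v)=1\}\subseteq V$. An attractor is a periodic orbit of the update (a cycle of distinct states, counted once irrespective of starting state); a fixed point is an attractor of period $1$. A complement two-cycle is a periodic orbit consisting of two states $S$ and $V\setminus S$, where $S$ is mapped to $V\setminus S$ and $V\setminus S$ is mapped to $S$; it is counted once as the unordered pair $\{S,V\setminus S\}$. *)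

(* Defs.v *)
From mathcomp Require Import all_boot.

Set Implicit Arguments.
Unset Strict Implicit.
Unset Printing Implicit Defensive.

Section Attractors.

Variables (T : finType) (f : T -> T).

(* A periodic orbit is represented by its set of states, so that it does not
   depend on a starting state; its period is then #|P|. *)
Definition attractor (P : {set T}) : bool :=
  (P != set0) &&
  [exists c : #|P|.-tuple T, [&& fcycle f c, uniq c & [set x in c] == P]].

Definition attractors : {set {set T}} := [set P | attractor P].

Definition fixed_points : {set {set T}} := [set P in attractors | #|P| == 1].

Lemma attractorP (P : {set T}) :
  reflect (exists c : seq T, [/\ c != [::], fcycle f c, uniq c & P =i c])
          (attractor P).
Proof.
apply: (iffP andP) => [[P0 /existsP[c /and3P[fc uc /eqP cP]]]|[c [c0 fc uc Pc]]].
  exists c; split=> //; last by move=> x; move/setP/(_ x): cP; rewrite inE => ->.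
  by rewrite -size_eq0 size_tuple cards_eq0.
have sz : size c == #|P| by rewrite (eq_card Pc) (card_uniqP uc).
split; first by rewrite -cards_eq0 -(eqP sz) size_eq0.
apply/existsP; exists (Tuple sz); rewrite /= fc uc /=.
by apply/eqP/setP => x; rewrite inE Pc.
Qed.

End Attractors.

Section Pulse.

Variables (V : finType) (e : rel V).

(* A state is identified with its active set; [e u v] is the edge u -> v. *)
Definition active_in_nbrs (S : {set V}) (v : V) : nat :=
  \sum_(u | e u v) (u \in S).

Definition pulse (S : {set V}) : {set V} :=
  [set v | prime (active_in_nbrs S v)].

Definition complement_two_cycles : {set {set {set V}}} :=
  [set P in attractors pulse |
     (#|P| == 2) &&
     [exists S : {set V},
        [&& P == [set S; ~: S], pulse S == ~: S & pulse (~: S) == S]]].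

End Pulse.

Definition complete_digraph (n : nat) : rel 'I_n := fun u v => u != v.

Definition num_attractors (n : nat) : nat :=
  #|attractors (pulse (@complete_digraph n))|.

Definition num_fixed_points (n : nat) : nat :=
  #|fixed_points (pulse (@complete_digraph n))|.

Definition num_complement_two_cycles (n : nat) : nat :=
  #|complement_two_cycles (@complete_digraph n)|.

(* Main.v *)
Require Import Defs.
From mathcomp Require Import all_boot.

(** On the complete digraph a vertex counts the active vertices other than
    itself, so every inactive vertex becomes active exactly when [#|S|] is
    prime, and every active vertex stays so exactly when [#|S|.-1] is prime.
    Hence a state [S] is sent to [S], to its complement, to the empty state or
    to the full state ([pulse_complete_cases]).  The empty state is fixed and
    the full state is sent to itself or to the empty state, so neither of the
    last two outcomes can occur on a periodic orbit that is not a fixed point: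
    a periodic state which eventually reaches a fixed point is that fixed point
    ([fcycle_iter_fixed]).  On any other orbit every step is therefore
    complementation, an involution, and the orbit is a complement two-cycle.
    Sorting the attractors by whether their period is 1 gives the formula. *)

Set Implicit Arguments.
Unset Strict Implicit.

Lemma fcycle_iter (T : finType) (f : T -> T) (c : seq T) (x y : T) :
  fcycle f c -> x \in c -> y \in c -> exists k, y = iter k f x.
Proof.
move=> fc xc yc; exists (findex f x y).
by rewrite iter_findex // (fconnect_cycle fc xc).
Qed.

(** The cycle returns from the fixed point [iter k f x] to [x], but iteration
    never leaves a fixed point. *)
Lemma fcycle_iter_fixed (T : finType) (f : T -> T) (c : seq T) (x : T) k :
  fcycle f c -> x \in c -> f (iter k f x) = iter k f x -> f x = x.
Proof.
move=> fc xc fix_k.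
have zc : iter k f x \in c by rewrite -(fconnect_cycle fc xc) fconnect_iter.
have [m ->] := fcycle_iter fc zc xc.
by rewrite (iter_fix m fix_k).
Qed.

Lemma attractor_closed (T : finType) (f : T -> T) (P : {set T}) (x : T) :
  attractor f P -> x \in P -> f x \in P.
Proof.
move=> /attractorP[c [_ fc _ Pc]]; rewrite !Pc => xc.
by rewrite -(fconnect_cycle fc xc) fconnect1.
Qed.

Lemma attractor_fixed (T : finType) (f : T -> T) (P : {set T}) (x : T) :
  attractor f P -> x \in P -> f x = x -> P = [set x].
Proof.
move=> /attractorP[c [_ fc _ Pc]] xP fx.
apply/setP=> y; rewrite inE; apply/idP/eqP => [yP|-> //].
have [k ->] : exists k, y = iter k f x.
  by apply: (fcycle_iter fc); rewrite -Pc.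
exact: iter_fix.
Qed.

Lemma attractor_two_cycle (T : finType) (f : T -> T) (P : {set T}) (x : T) :
  attractor f P -> x \in P -> f (f x) = x -> P = [set x; f x].
Proof.
move=> aP xP ffx; have [c [_ fc _ Pc]] := attractorP _ _ aP.
apply/setP=> y; rewrite !inE; apply/idP/orP => [yP|[]/eqP-> //].
  have [k ->] : exists k, y = iter k f x.
    by apply: (fcycle_iter fc); rewrite -Pc.
  elim: k => [|k [/eqP IHk|/eqP IHk]]; first by left.
    by right; rewrite iterS IHk.
  by left; rewrite iterS IHk ffx.
exact: attractor_closed aP xP.
Qed.

Section CompleteDigraph.

Variable n : nat.

Local Notation f := (pulse (@complete_digraph n)).

Lemma in_pulse_complete (S : {set 'I_n}) v :
  (v \in f S) = prime (#|S| - (v \in S)).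
Proof.
rewrite inE; congr prime; rewrite /active_in_nbrs /complete_digraph.
rewrite -[#|S|]sum1_card [in RHS]big_mkcond [in RHS](bigD1 v) //=.
rewrite -[if v \in S then 1 else 0]/(nat_of_bool (v \in S)) addKn.
by apply: eq_bigr => u _; case: (u \in S).
Qed.

Lemma pulse_complete0 : f set0 = set0.
Proof. by apply/setP=> v; rewrite in_pulse_complete cards0 !inE. Qed.

Lemma pulse_completeT : f setT = setT \/ f setT = set0.
Proof.
case p: (prime (#|[set: 'I_n]| - 1)); [left | right];
  by apply/setP=> v; rewrite in_pulse_complete !inE p.
Qed.

(** The four outcomes are the four truth values of the pair
    ([prime #|S|], [prime #|S|.-1]). *)
Lemma pulse_complete_cases (S : {set 'I_n}) :
  [\/ f S = S, f S = ~: S, f S = set0 | f S = setT].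
Proof.
case p0: (prime (#|S| - false)); case p1: (prime (#|S| - true));
  [apply: Or44 | apply: Or42 | apply: Or41 | apply: Or43];
  by apply/setP=> v; rewrite in_pulse_complete ?inE; case: (v \in S).
Qed.

(** A constant outcome reaches a fixed point after one more step at most, which
    would make [S] itself fixed. *)
Lemma periodic_pulse_complete (c : seq {set 'I_n}) (S : {set 'I_n}) :
  fcycle f c -> S \in c -> f S != S -> f S = ~: S.
Proof.
move=> fc Sc nfix.
have ev k : f (iter k f S) = iter k f S -> f S = ~: S.
  by move/(fcycle_iter_fixed fc Sc)/eqP; rewrite (negPf nfix).
case: (pulse_complete_cases S) => // fS.
- by rewrite fS eqxx in nfix.
- by apply: (ev 1); rewrite /= fS pulse_complete0.
- have [fT | fT] := pulse_completeT; first by apply: (ev 1); rewrite /= fS.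
  by apply: (ev 2); rewrite /= fS fT pulse_complete0.
Qed.

Lemma complement_two_cyclesE :
  complement_two_cycles (@complete_digraph n)
    = [set P in attractors f | #|P| != 1].
Proof.
apply/setP=> P; rewrite !inE; apply: andb_id2l => aP.
apply/andP/idP => [[/eqP-> //]|cardP].
have [c [_ fc _ Pc]] := attractorP _ _ aP.
have /andP[/set0Pn[S SP] _] := aP.
have nfix Q : Q \in P -> f Q != Q.
  move=> QP; apply: contra cardP => /eqP fQ.
  by rewrite (attractor_fixed aP QP fQ) cards1.
have compl Q : Q \in P -> f Q = ~: Q.
  by move=> QP; apply: (periodic_pulse_complete fc); rewrite -?Pc ?nfix.
have fSP := attractor_closed aP SP.
have ffS : f (f S) = S by rewrite (compl _ fSP) (compl _ SP) setCK.
have defP := attractor_two_cycle aP SP ffS.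
split; first by rewrite defP cards2 (eq_sym S) nfix.
by apply/existsP; exists S; rewrite -(compl _ SP) -defP ffS !eqxx.
Qed.

End CompleteDigraph.

Unset Implicit Arguments.

Theorem corollary17 (n : nat) (hn : 1 <= n) :
  num_attractors n = num_fixed_points n + num_complement_two_cycles n.
Proof.
rewrite /num_complement_two_cycles complement_two_cyclesE.
rewrite /num_attractors /num_fixed_points /fixed_points.
rewrite -(cardsID [set P : {set {set 'I_n}} | #|P| == 1]).
by congr (_ + _); apply: eq_card => P; rewrite !inE // andbC.
Qed.
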